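(* Let $B\in\mathbb{C}^{m\times n}$ be written as $$B=U\begin{pmatrix}D_b&0\\0&0\end{pmatrix}V^*,$$ where $U\in\mathbb{C}^{m\times m}$ and $V\in\mathbb{C}^{n\times n}$ are unitary matrices and $D_b\in\mathbb{C}^{b\times b}$ is a positive definite diagonal matrix. For a matrix $A\in\mathbb{C}^{m\times n}$, the following conditions are equivalent: (a) $A\leq^\diamond B$. (b) There exists $T\in\mathbb{C}^{b\times b}$ with $T\leq^\diamond D_b$ such that $$A=U\begin{pmatrix}T&0\\0&0\end{pmatrix}V^*.$$
   Context: $A^*$ is the conjugate transpose and $\mathcal{R}(\cdot)$ the range (column space) of a complex matrix. The diamond partial order on complex matrices of a given size is defined by: $A\leq^\diamond B$ iff $\mathcal{R}(A)\subseteq\mathcal{R}(B)$, $\mathcal{R}(A^* )\subseteq\mathcal{R}(B^* )$ and $AB^*A=AA^*A$. The block matrices are $m\times n$ with leading block of size $b\times b$. *)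

(* Defs.v *)
From mathcomp Require Import all_boot all_order all_algebra.
From mathcomp Require Import classical_sets reals.
From mathcomp Require Export complex.

Set Implicit Arguments.
Unset Strict Implicit.
Unset Printing Implicit Defensive.

Import GRing.Theory Num.Theory.
Local Open Scope classical_set_scope.
Local Open Scope ring_scope.
Local Open Scope sesquilinear_scope.

Section Diamond.
Context {C : numClosedFieldType}.

Definition mxrange m n (A : 'M[C]_(m, n)) : set 'cV[C]_m :=
  range (fun x : 'cV[C]_n => A *m x).

Definition diamond_le m n (A B : 'M[C]_(m, n)) : Prop :=
  [/\ mxrange A `<=` mxrange B,
      mxrange (A ^t*) `<=` mxrange (B ^t*) &
      A *m B ^t* *m A = A *m A ^t* *m A].

(* In a numClosedFieldType, [0 < z] entails that [z] is real. *)
Definition posdefmx n (A : 'M[C]_n) : Prop :=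
  A \is hermsymmx /\
  forall x : 'cV[C]_n, x != 0 -> 0 < (x ^t* *m A *m x) 0 0.

End Diamond.

(* Main.v *)
(** A range inclusion R(A) <= R(B) is a factorisation A = B X. Hence A <=^diamond B
    means that A = B X = Y B and A B^* A = A A^* A, a condition invariant under
    A, B |-> U A V^*, U B V^*, so one may take U = V = 1. Then A = B X kills the lower
    blocks of A, A = Y B kills its right blocks, and every condition reduces to
    the same one on the leading blocks. *)
Require Import Defs.
From mathcomp Require Import all_boot all_order all_algebra.
From mathcomp Require Import reals.
From mathcomp Require Import classical_sets.
Local Open Scope ring_scope.
Local Open Scope sesquilinear_scope.
Import GRing.Theory.

Section DiamondOrder.
Set Implicit Arguments.
Unset Strict Implicit.
Context {C : numClosedFieldType}.

(** Each column of [A] is the image of a basis vector, so the inclusion gives it a preimage under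
    [B]; finitely many chosen preimages are the columns of [X]. *)
Lemma mxrange_subP m n p (A : 'M[C]_(m, n)) (B : 'M[C]_(m, p)) :
  (mxrange A `<=` mxrange B)%classic <-> exists X, A = B *m X.
Proof.
split=> [AB | [X ->] _ [x _ <-]]; last by exists (X *m x) => //; rewrite mulmxA.
have /fin_all_exists[x Ax] j : exists x, B *m x = col j A.
  by have [|x _ Bx] := AB (col j A); [exists (delta_mx j 0) => //; rewrite colE | exists x].
exists (\matrix_(i, j) x j i 0); apply/matrixP => i j.
have := congr1 (fun v : 'cV_m => v i 0) (Ax j); rewrite !mxE => <-.
by apply: eq_bigr => k _; rewrite !mxE.
Qed.

Lemma adjmxM m n p (A : 'M[C]_(m, n)) (B : 'M[C]_(n, p)) :
  (A *m B) ^t* = B ^t* *m A ^t*.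
Proof. by rewrite trmx_mul map_mxM. Qed.

Lemma adjmx_block m1 m2 n1 n2 (A : 'M[C]_(m1, n1)) (B : 'M[C]_(m1, n2))
    (E : 'M[C]_(m2, n1)) (F : 'M[C]_(m2, n2)) :
  (block_mx A B E F) ^t* = block_mx (A ^t*) (E ^t*) (B ^t*) (F ^t*).
Proof. by rewrite tr_block_mx map_block_mx. Qed.

Lemma adjmx0 m n : (0 : 'M[C]_(m, n)) ^t* = 0.
Proof. by rewrite trmx0 map_mx0. Qed.

(** Taking adjoints turns a right factorisation of [A ^t*] through [B ^t*] into a left factorisation
    of [A] through [B]. *)
Lemma diamond_leP m n (A B : 'M[C]_(m, n)) :
  diamond_le A B <->
  [/\ exists X, A = B *m X, exists Y, A = Y *m B
    & A *m B ^t* *m A = A *m A ^t* *m A].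
Proof.
split=> -[AB ABt eqAB]; split=> //; first by apply/mxrange_subP.
- have /mxrange_subP[Y eqA] := ABt.
  by exists (Y ^t*); rewrite -[A]trmxCK eqA adjmxM trmxCK.
- by apply/mxrange_subP.
- by apply/mxrange_subP; have [Y ->] := ABt; exists (Y ^t*); rewrite adjmxM.
Qed.

(** The inner products [V ^t* *m V] and [U ^t* *m U] cancel, so the factors [X] and [Y] need only be
    conjugated by [V] and [U] respectively. *)
Lemma diamond_le_unitary m n (U : 'M[C]_m) (V : 'M[C]_n) (A B : 'M[C]_(m, n)) :
  U \is unitarymx -> V \is unitarymx ->
  diamond_le A B -> diamond_le (U *m A *m V ^t*) (U *m B *m V ^t*).
Proof.
move=> Uu Vu /diamond_leP[[X eqX] [Y eqY] eqAB]; apply/diamond_leP.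
have UK k (M : 'M_(k, m)) : M *m U ^t* *m U = M by rewrite mulmxKtV.
have VK k (M : 'M_(k, n)) : M *m V ^t* *m V = M by rewrite mulmxKtV.
split.
- by exists (V *m X *m V ^t*); rewrite {1}eqX !mulmxA VK.
- by exists (U *m Y *m U ^t*); rewrite {1}eqY !mulmxA UK.
- by rewrite !adjmxM !trmxCK !mulmxA !VK !UK -!(mulmxA U) eqAB.
Qed.

Lemma diamond_le_block b p q (D : 'M[C]_b) (A : 'M[C]_(b + p, b + q)) :
  diamond_le A (block_mx D 0 0 0) <->
  exists T, diamond_le T D /\ A = block_mx T 0 0 0.
Proof.
split=> [/diamond_leP[[X eqX] [Y eqY] eqAB] | [T [/diamond_leP]]]; last first.
  (* Padding the factors with zero blocks lifts the factorisations of [T] to the full size. *)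
  move=> [[X eqX] [Y eqY] eqTD] ->; apply/diamond_leP; split.
  - by exists (block_mx X 0 0 0); rewrite mulmx_block !(mul0mx, mulmx0, addr0) -eqX.
  - by exists (block_mx Y 0 0 0); rewrite mulmx_block !(mul0mx, mulmx0, addr0) -eqY.
  - by rewrite !adjmx_block !adjmx0 !mulmx_block !(mul0mx, mulmx0, addr0) eqTD.
move: eqX eqY eqAB; rewrite -[X]submxK -[Y]submxK -[A]submxK.
rewrite !mulmx_block !(mul0mx, mulmx0, addr0).
move=> /eq_block_mx[eqX _ -> ->] /eq_block_mx[eqY -> _ _].
rewrite !adjmx_block !adjmx0 !mulmx_block !(mul0mx, mulmx0, addr0).
(* The upper-left blocks of the three equations are exactly the three conditions on [ulsubmx A] and
   [D]. *)
move=> /eq_block_mx[eqTD _ _ _]; exists (ulsubmx A); split=> //.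
by apply/diamond_leP; split=> //; [exists (ulsubmx X) | exists (ulsubmx Y)].
Qed.

End DiamondOrder.

Theorem theorem2p6 (R : realType) (b p q : nat)
    (U : 'M[R[i]]_(b + p)) (V : 'M[R[i]]_(b + q)) (D : 'M[R[i]]_b)
    (B : 'M[R[i]]_(b + p, b + q))
    (hU : U \is unitarymx) (hV : V \is unitarymx)
    (hDdiag : is_diag_mx D) (hDpos : posdefmx D)
    (hB : B = U *m block_mx D 0 0 0 *m V ^t*)
    (A : 'M[R[i]]_(b + p, b + q)) :
  diamond_le A B <->
  exists T : 'M[R[i]]_b,
    diamond_le T D /\ A = U *m block_mx T 0 0 0 *m V ^t*.
Proof.
have Uu : U ^t* \is unitarymx by rewrite trmxC_unitary.
have Vu : V ^t* \is unitarymx by rewrite trmxC_unitary.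
rewrite hB; split=> [AB | [T [TD ->]]]; last first.
  by apply: diamond_le_unitary => //; apply/diamond_le_block; exists T.
(* The change of bases is undone by the same invariance, applied to the unitary matrices [U ^t*] and
   [V ^t*]; hence the double adjoint of [V]. *)
have UVK M : U ^t* *m (U *m M *m V ^t*) *m V ^t* ^t* = M.
  by rewrite trmxCK !mulmxA mulmxKtV // -{2}[U]trmxCK (unitarymxP Uu) mul1mx.
have := diamond_le_unitary Uu Vu AB; rewrite UVK.
move=> /diamond_le_block[T [TD eqT]]; exists T; split=> //.
have := congr1 (fun M => U *m M *m V ^t*) eqT; rewrite /= => <-.
by rewrite trmxCK !mulmxA mulmxtVK // (unitarymxP hU) mul1mx.
Qed.
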